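(* Let $I=(G=(V,E),\mathcal{C},\omega,n-1,b)$ be an instance of \textsc{Connectivity NWS} with $n=|V|$ such that the hypergraph $(V,\mathcal{C})$ is connected. Consider the following algorithm: if $G$ is not connected, output that there is no solution; otherwise, let $X-1$ be the maximum edge weight in $G$, define for each edge $e$ the weight $\widetilde\omega(e)=z_e+\frac{X-\omega(e)}{X}$ where $z_e$ is the number of communities containing both endpoints of $e$, compute with Kruskal's algorithm a maximum-weight spanning tree $T$ of $G$ with respect to $\widetilde\omega$, output $T$ if $T$ is a solution for $I$, and otherwise output that there is no solution. This algorithm runs in $\mathcal{O}(m\cdot(c+\log n))$ time and either finds a minimum-weight solution for $I$ or correctly outputs that $I$ has no solution.
   Context: \textsc{Connectivity NWS}: given a graph $G=(V,E)$ with $m$ edges, a collection $\mathcal{C}$ of $c$ subsets of $V$ (communities), $\omega:E\to\mathbb{R}_+$, an integer $\ell$ and a positive real $b$, a solution is a spanning subgraph $G'=(V,E')$ with $E'\subseteq E$, $|E'|\le\ell$, $\omega(E')\le b$, such that $G'[C]$ is connected for all $C\in\mathcal{C}$. The hypergraph $(V,\mathcal{C})$ is connected if any two vertices are joined by a sequence of communities, consecutive ones intersecting, the first containing one vertex and the last the other. *)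

(* Defs.v *)
From HB Require Import structures.
From mathcomp Require Export all_boot all_order all_algebra reals.

Set Implicit Arguments.
Unset Strict Implicit.
Unset Printing Implicit Defensive.

Import Order.TTheory GRing.Theory Num.Theory.

Local Open Scope ring_scope.

Section Problem.

Variables (R : realFieldType) (V : finType).

(* Communities form a sequence, so c is its size and a community that occurs
   several times is counted with multiplicity.  Values of [omega] outside
   [edges] are irrelevant. *)
Record cnws := Cnws {
  edges : {set {set V}};
  comms : seq {set V};
  omega : {set V} -> R;
  ell : int;
  budget : R;
  edges_card2 : forall e, e \in edges -> #|e| = 2;
  omega_ge0 : forall e, e \in edges -> 0 <= omega e;
  budget_gt0 : 0 < budget
}.

Definition adj (F : {set {set V}}) : rel V := [rel x y | [set x; y] \in F].

(* The graph (W, F), whose edges are assumed to lie inside W, is connected. *)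
Definition connected_graph (W : {set V}) (F : {set {set V}}) : Prop :=
  forall x y, x \in W -> y \in W -> connect (adj F) x y.

Definition induced_edges (F : {set {set V}}) (C : {set V}) : {set {set V}} :=
  [set e in F | e \subset C].

Definition weight (I : cnws) (F : {set {set V}}) : R :=
  \sum_(e in F) omega I e.

Definition solution (I : cnws) (F : {set {set V}}) : Prop :=
  [/\ F \subset edges I,
      #|F|%:Z <= ell I,
      weight I F <= budget I &
      forall C, C \in comms I -> connected_graph C (induced_edges F C)].

Definition min_weight_solution (I : cnws) (F : {set {set V}}) : Prop :=
  solution I F /\ forall F', solution I F' -> weight I F <= weight I F'.

Definition hypergraph_connected (cs : seq {set V}) : Prop :=
  forall u v : V, u != v ->
  exists (C : {set V}) (s : seq {set V}),
    [/\ {subset C :: s <= cs},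
        path [rel A B : {set V} | A :&: B != set0] C s,
        u \in C &
        v \in last C s].

End Problem.

(* Cost model.  A computation returns the number of steps together with its
   result.  Every unfolding of a recursive function below costs one step, and
   between two steps only a bounded number of unit-cost operations of a real
   RAM is performed: arithmetic and comparisons on numbers, tests on vertices,
   construction and destruction of list cells, reading and writing a cell of an
   array indexed by V, and the test whether a vertex lies in a community.
   The number n = #|V| is known to the machine, which can run through the
   vertices; allocating an array indexed by V costs n steps. *)

Definition timed (A : Type) : Type := (nat * A)%type.

Definition cost A (t : timed A) : nat := t.1.
Definition result A (t : timed A) : A := t.2.

Definition ret A (a : A) : timed A := (0%N, a).
Definition charge A (k : nat) (t : timed A) : timed A := ((k + t.1)%N, t.2).
Definition tick A (t : timed A) : timed A := charge 1 t.
Definition bind A B (t : timed A) (f : A -> timed B) : timed B :=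
  charge t.1 (f t.2).

Notation "'let*' x ':=' t 'in' k" := (bind t (fun x => k))
  (at level 200, x name, t at level 100, k at level 200).

Section ListPrograms.

Variables A B : Type.

(* [p], [f] in [countT] and [foldT] must be unit-cost operations. *)
Fixpoint countT (p : pred A) (s : seq A) : timed nat :=
  tick (if s is x :: s' then
          let* k := countT p s' in ret (p x + k)%N
        else ret 0%N).

Fixpoint foldT (f : A -> B -> B) (b : B) (s : seq A) : timed B :=
  tick (if s is x :: s' then
          let* r := foldT f b s' in ret (f x r)
        else ret b).

Fixpoint mapT (f : A -> timed B) (s : seq A) : timed (seq B) :=
  tick (if s is x :: s' then
          let* y := f x in
          let* r := mapT f s' in
          ret (y :: r)
        else ret [::]).

Fixpoint allT (p : A -> timed bool) (s : seq A) : timed bool :=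
  tick (if s is x :: s' then
          let* b := p x in
          if b then allT p s' else ret false
        else ret true).

End ListPrograms.

(* Bottom-up merge sort; [le] must be a unit-cost comparison. *)
Section MergeSort.

Variables (A : Type) (le : rel A).

Fixpoint mergeT (s1 : seq A) : seq A -> timed (seq A) :=
  fix mergeT_s1 (s2 : seq A) : timed (seq A) :=
    tick (match s1, s2 with
          | [::], _ => ret s2
          | _, [::] => ret s1
          | x1 :: s1', x2 :: s2' =>
              if le x1 x2 then
                let* s := mergeT s1' s2 in ret (x1 :: s)
              else
                let* s := mergeT_s1 s2' in ret (x2 :: s)
          end).

Fixpoint merge_pairsT (ss : seq (seq A)) : timed (seq (seq A)) :=
  tick (match ss with
        | s1 :: s2 :: ss' =>
            let* s := mergeT s1 s2 in
            let* r := merge_pairsT ss' in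
            ret (s :: r)
        | _ => ret ss
        end).

(* [fuel] only serves termination: [size ss] is always sufficient. *)
Fixpoint merge_allT (fuel : nat) (ss : seq (seq A)) : timed (seq A) :=
  tick (match ss, fuel with
        | [::], _ => ret [::]
        | [:: s], _ => ret s
        | s :: _, 0 => ret s
        | _, fuel'.+1 =>
            let* ss' := merge_pairsT ss in
            merge_allT fuel' ss'
        end).

Definition sortT (s : seq A) : timed (seq A) :=
  let* ss := mapT (fun x => ret [:: x]) s in
  merge_allT (size s) ss.

End MergeSort.

Section Algorithm.

Variables (R : realFieldType) (V : finType).

(* An edge as stored by the machine: its two ends and its weight. *)
Record edge := Edge { src : V; dst : V; wgt : R }.

Definition ends (e : edge) : {set V} := [set src e; dst e].

(* [es] lists every edge of the instance exactly once, in any order and with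
   either orientation. *)
Definition encodes (I : cnws R V) (es : seq edge) : Prop :=
  perm_eq (map ends es) (enum (edges I)) /\
  map wgt es = map (omega I \o ends) es.

Definition edge_set (T : seq edge) : {set {set V}} :=
  [set f in map ends T].

(* Disjoint-set forest with union by size. *)
Record dsf := Dsf { parent : V -> V; card_of : V -> nat }.

Definition write A (a : V -> A) (x : V) (y : A) : V -> A :=
  fun z => if z == x then y else a z.

Definition new_dsf : timed dsf :=
  charge (#|V| + #|V|) (ret (Dsf id (fun=> 1%N))).

(* [fuel] only serves termination: [#|V|] is always sufficient. *)
Fixpoint findT (d : dsf) (fuel : nat) (x : V) : timed V :=
  tick (if parent d x == x then ret x
        else if fuel is fuel'.+1 then findT d fuel' (parent d x)
        else ret x).

Definition link (d : dsf) (x y : V) : dsf :=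
  let k := (card_of d x + card_of d y)%N in
  if (card_of d x < card_of d y)%N
  then Dsf (write (parent d) x y) (write (card_of d) y k)
  else Dsf (write (parent d) y x) (write (card_of d) x k).

Fixpoint greedyT (d : dsf) (es : seq edge) : timed (seq edge) :=
  tick (if es is e :: es' then
          let* x := findT d #|V| (src e) in
          let* y := findT d #|V| (dst e) in
          if x == y then greedyT d es'
          else
            let* F := greedyT (link d x y) es' in
            ret (e :: F)
        else ret [::]).

Definition greedy_forestT (es : seq edge) : timed (seq edge) :=
  let* d := new_dsf in greedyT d es.

(* A graph is connected iff it has a spanning forest with n - 1 edges.  With
   fewer than n - 1 edges the answer is given before allocating any array. *)
Definition connectedT (es : seq edge) : timed bool :=
  let* m := countT predT es in
  if (m.+1 < #|V|)%N then ret false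
  else
    let* F := greedy_forestT es in
    let* k := countT predT F in
    ret (#|V| <= k.+1)%N.

(* X, where X - 1 is the maximum edge weight (0 if there is no edge). *)
Definition maxweight1T (es : seq edge) : timed R :=
  let* w := foldT (fun e r => Num.max (wgt e) r) 0 es in
  ret (w + 1).

Definition tilde_omegaT (cs : seq {set V}) (X : R) (e : edge) : timed R :=
  let* z := countT (fun C : {set V} => (src e \in C) && (dst e \in C)) cs in
  ret (z%:R + (X - wgt e) / X).

(* Kruskal's algorithm for a maximum-weight spanning tree: [ks] lists the edges
   together with their weights. *)
Definition kruskalT (ks : seq (edge * R)) : timed (seq edge) :=
  let* ks' := sortT (fun p q : edge * R => q.2 <= p.2) ks in
  let* es := mapT (fun p => ret p.1) ks' in
  greedy_forestT es.

(* T is a forest, hence T[C] is connected iff it has at least |C| - 1 edges. *)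
Definition comm_connectedT (T : seq edge) (C : {set V}) : timed bool :=
  let* k := countT (fun v => v \in C) (enum V) in
  let* l := countT (fun e => (src e \in C) && (dst e \in C)) T in
  ret (k <= l.+1)%N.

Definition is_solutionT (cs : seq {set V}) (l : int) (b : R) (T : seq edge) :
    timed bool :=
  let* k := countT predT T in
  let* w := foldT (fun e r => wgt e + r) 0 T in
  if (k%:Z <= l) && (w <= b) then allT (comm_connectedT T) cs else ret false.

(* [None] means: there is no solution. *)
Definition algorithm (es : seq edge) (cs : seq {set V}) (l : int) (b : R) :
    timed (option (seq edge)) :=
  let* conn := connectedT es in
  if ~~ conn then ret None
  else
    let* X := maxweight1T es in
    let* ks := mapT (fun e => let* w := tilde_omegaT cs X e in ret (e, w)) es in
    let* T := kruskalT ks in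
    let* ok := is_solutionT cs l b T in
    ret (if ok then Some T else None).

End Algorithm.

(* Main.v *)
Require Import Defs.
From HB Require Import structures.
From mathcomp Require Import zify ring lra.

Set Implicit Arguments.
Unset Strict Implicit.
Unset Printing Implicit Defensive.

Import Order.TTheory GRing.Theory Num.Theory.

Local Open Scope ring_scope.

(* Over F_2 the incidence vectors of a set of edges are free iff the edges form
   a forest, and x, y are connected by the edges iff the sum of the unit vectors
   of x and y lies in the span.  Kruskal's algorithm is thus the greedy
   construction of a basis from a sorted list of vectors, which is optimal for
   every nonnegative weight that is monotone along the list.  The list sorted by
   tilde_omega is sorted lexicographically, so the greedy tree T is optimal both
   for the multiplicity z and for tilde_omega, although the fractional parts may
   add up to more than 1.

   A forest has at most |C| - 1 edges inside a community C, with equality iff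
   it connects C; summing over the communities, the solutions are the spanning
   trees within budget whose total multiplicity attains this bound.  If a
   solution F exists, then z(T) >= z(F) forces T to connect every community, and
   z(T) = z(F) together with the optimality for tilde_omega gives
   omega(T) <= omega(F).

   For the running time, union by size keeps 2^(depth of x) below the size of
   the tree of x, and m <= n^2 bounds the number of rounds of the merge sort by
   2 (log n + 1). *)

Lemma leq_predLR m n : (m.-1 <= n)%N = (m <= n.+1)%N.
Proof. by case: m. Qed.

Lemma mulSS_leq_maxn m n : (m.+1 * n.+1 <= 4 * (maxn 1 m * maxn 1 n))%N.
Proof.
have le_maxn k : (k.+1 <= 2 * maxn 1 k)%N by lia.
by rewrite -[4%N]/(2 * 2)%N mulnACA leq_mul.
Qed.

Section Greedy.

Variables (K : fieldType) (vT : vectType K).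

Fixpoint greedy (E : Type) (vec : E -> vT) (U : {vspace vT}) (es : seq E) :
    seq E :=
  if es is e :: es' then
    if vec e \in U then greedy vec U es'
    else e :: greedy vec (U + <[vec e]>) es'
  else [::].

Lemma map_greedy (E1 E2 : Type) (f : E1 -> E2) (vec : E2 -> vT) U es :
  map f (greedy (vec \o f) U es) = greedy vec U (map f es).
Proof. by elim: es U => //= e es IH U; case: ifP => _ /=; rewrite IH. Qed.

Lemma subseq_greedy (E : eqType) (vec : E -> vT) U es :
  subseq (greedy vec U es) es.
Proof.
elim: es U => //= e es IH U; case: ifP => _; last by rewrite eqxx.
by apply: subseq_trans (IH U) (subseq_cons _ _).
Qed.

Lemma dim_add_line (U : {vspace vT}) v :
  v \notin U -> \dim (U + <[v]>) = (\dim U).+1.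
Proof.
move=> vU; rewrite dimv_disjoint_sum ?dim_vline.
  by case: eqVneq vU => [->|]; rewrite ?mem0v ?addn1.
apply/eqP; rewrite -subv0; apply/subvP => u; rewrite memv_cap memv0.
case/andP=> uU /vlineP[k uE]; move: uU; rewrite uE rpredZeq (negPf vU) orbF.
by move/eqP->; rewrite scale0r.
Qed.

Section Basis.

Variables (E : Type) (vec : E -> vT).

Lemma greedy_cat U es1 es2 :
  greedy vec U (es1 ++ es2) =
  greedy vec U es1 ++ greedy vec (U + <<map vec es1>>) es2.
Proof.
elim: es1 U => [|e es1 IH] U /=; first by rewrite span_nil addv0.
rewrite span_cons addvA; case: ifP => [eU|_]; rewrite IH //.
by rewrite (addv_idPl (_ : (<[vec e]> <= U)%VS)).
Qed.

Lemma span_greedy U es :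
  (U + <<map vec (greedy vec U es)>> = U + <<map vec es>>)%VS.
Proof.
elim: es U => //= e es IH U; rewrite span_cons addvA.
case: ifP => [eU|_] /=; last by rewrite span_cons addvA IH.
by rewrite IH [in RHS](addv_idPl (_ : (<[vec e]> <= U)%VS)).
Qed.

Lemma dim_add_greedy U es :
  \dim (U + <<map vec (greedy vec U es)>>) =
  (\dim U + size (greedy vec U es))%N.
Proof.
elim: es U => [|e es IH] U /=; first by rewrite span_nil addv0 addn0.
case: ifPn => //= eU; rewrite span_cons addvA IH dim_add_line //.
by rewrite addSnnS.
Qed.

Lemma size_greedy es : size (greedy vec 0 es) = \dim <<map vec es>>.
Proof. by rewrite -[X in \dim X]add0v -span_greedy dim_add_greedy dimv0. Qed.

Lemma free_greedy es : free (map vec (greedy vec 0 es)).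
Proof. by rewrite /free -[X in \dim X]add0v dim_add_greedy dimv0 size_map. Qed.

End Basis.

Lemma free_map_filter (E : eqType) (vec : E -> vT) (p : pred E) s :
  free (map vec s) -> free (map vec (filter p s)).
Proof.
have /(perm_map vec)/perm_free <- :
    perm_eq (filter p s ++ filter (predC p) s) s.
  by rewrite perm_filterC.
by rewrite map_cat => /catl_free.
Qed.

Lemma sub_map_span (E : eqType) (vec : E -> vT) s1 s2 :
  {subset s1 <= s2} -> (<<map vec s1>> <= <<map vec s2>>)%VS.
Proof.
move=> sub; apply: sub_span => v /mapP[e e_s1 ->].
by rewrite map_f // sub.
Qed.

Section Optimality.

Variables (E : eqType) (vec : E -> vT) (R : realFieldType).

(* Abel summation: subtracting the least weight [w e] from all weights discards
   [e] and costs [w e] per element, and the greedy basis is the larger one. *)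
Lemma greedy_max_weight (w : E -> R) es s :
  pairwise (fun e f => w f <= w e) es -> {in es, forall e, 0 <= w e} ->
  {subset s <= es} -> free (map vec s) ->
  \sum_(e <- s) w e <= \sum_(e <- greedy vec 0 es) w e.
Proof.
elim/last_ind: es w s => [|es e IH] w s.
  case: s => [|f s] _ _ sub _; first by rewrite !big_nil.
  by have := sub f (mem_head _ _).
rewrite pairwise_rcons => /andP[/allP ge_e es_sorted] w_ge0 sub free_s.
have sum_shift t :
    \sum_(f <- t) w f = \sum_(f <- t) (w f - w e) + w e *+ size t.
  by rewrite sumrB big_const_seq count_predT iter_addr_0 subrK.
have sum_s : \sum_(f <- s) (w f - w e) =
             \sum_(f <- filter (predC1 e) s) (w f - w e).
  rewrite big_filter [LHS](bigID (pred1 e)) /= big1 ?add0r //.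
  by move=> f /eqP->; rewrite subrr.
have sum_greedy : \sum_(f <- greedy vec 0 (rcons es e)) (w f - w e) =
                  \sum_(f <- greedy vec 0 es) (w f - w e).
  rewrite -cats1 greedy_cat /= big_cat /=.
  by case: ifP => _; rewrite ?big_seq1 ?big_nil ?subrr addr0.
rewrite !{}sum_shift {}sum_s {}sum_greedy lerD //.
  apply: IH; last exact: free_map_filter.
  - by apply: sub_pairwise es_sorted => f g /=; rewrite lerD2r.
  - by move=> f f_es; rewrite subr_ge0; apply: ge_e.
  - move=> f; rewrite mem_filter /= => /andP[fe /sub].
    by rewrite mem_rcons inE (negPf fe).
apply: ler_wpMn2l; first by rewrite w_ge0 // mem_rcons mem_head.
rewrite size_greedy; move: free_s; rewrite /free size_map => /eqP <-.
exact/dimvS/sub_map_span.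
Qed.

End Optimality.

End Greedy.

Section Incidence.

Variable V : finType.

Local Notation space := {ffun V -> ('F_2)^o}.

Implicit Types (x y z : V) (A C e : {set V}) (S T : seq {set V}).
Implicit Types (F : {set {set V}}) (U : {vspace space}).

Definition simple_graph S : bool := all (fun e => #|e| == 2) S.

(* Over F_2 the incidence vector of an edge needs no orientation. *)
Definition incid A : space := [ffun z => (z \in A)%:R].

Definition unitv x : space := incid [set x].

Definition graph_rank S : nat := \dim <<map incid S>>.

Definition forest S : bool := free (map incid S).

Lemma simple_graph_end_neq S x y : simple_graph S -> [set x; y] \in S -> x != y.
Proof. by move=> /allP simpleS /simpleS; rewrite cards2; case: (x == y). Qed.

Lemma simple_graph_sub S T :
  {subset S <= T} -> simple_graph T -> simple_graph S.
Proof. by move=> sub /allP simpleT; apply/allP => e /sub/simpleT. Qed.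

Lemma forest_uniq S : forest S -> uniq S.
Proof. by move/free_uniq/map_uniq. Qed.

Lemma forest_rank S : forest S -> graph_rank S = size S.
Proof. by move/eqP; rewrite size_map. Qed.

Lemma graph_rank_sub S T : {subset S <= T} -> (graph_rank S <= graph_rank T)%N.
Proof. by move=> sub; apply/dimvS/sub_map_span. Qed.

Lemma graph_rank_perm S T : perm_eq S T -> graph_rank S = graph_rank T.
Proof. by move=> perm; congr (\dim _); apply/eq_span/perm_mem/perm_map. Qed.

Lemma graph_rank_size S : (graph_rank S <= size S)%N.
Proof. by rewrite -(size_map incid) dim_span. Qed.

Lemma addvv (v : space) : v + v = 0.
Proof.
by apply/ffunP => z; rewrite !ffunE; apply: GRing.addrr_pchar2; apply: pchar_Fp.
Qed.

Lemma incid2 x y : x != y -> incid [set x; y] = unitv x + unitv y.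
Proof.
move=> xy; apply/ffunP => z; rewrite !ffunE !inE.
by case: (eqVneq z x) => [->|]; rewrite ?(negPf xy) ?addr0 ?add0r.
Qed.

Lemma unitv_add_trans x y z U :
  unitv x + unitv y \in U -> unitv y + unitv z \in U -> unitv x + unitv z \in U.
Proof.
move=> xy yz; have := memvD xy yz.
by rewrite addrA -(addrA (unitv x)) addvv addr0.
Qed.

Lemma sum_unitv A x : \sum_(z in A) unitv x z = (x \in A)%:R.
Proof.
under eq_bigr do rewrite ffunE inE.
case: (boolP (x \in A)) => xA.
  by rewrite (bigD1 x) //= eqxx big1 ?addr0 // => z /andP[_ /negPf->].
by rewrite big1 // => z zA; case: eqVneq zA => // ->; rewrite (negPf xA).
Qed.

Lemma span_sum_eq0 A (X : seq space) (v : space) :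
  (forall u, u \in X -> \sum_(z in A) u z = 0) ->
  v \in <<X>>%VS -> \sum_(z in A) v z = 0.
Proof.
move=> sumX_eq0 /(@coord_span _ _ _ (in_tuple X)) ->.
under eq_bigr do rewrite sum_ffunE.
rewrite exchange_big big1 //= => i _.
under eq_bigr do rewrite ffunE.
by rewrite -mulr_sumr sumX_eq0 ?mulr0 // mem_nth.
Qed.

Lemma free_unitv (s : seq V) : uniq s -> free (map unitv s).
Proof.
elim: s => [|x s IH]; first by rewrite nil_free.
move=> /= /andP[x_s /IH free_s]; rewrite free_cons free_s andbT.
apply/negP => /(@span_sum_eq0 [set x]); rewrite sum_unitv set11.
have sum_eq0 u : u \in map unitv s -> \sum_(z in [set x]) u z = 0.
  case/mapP=> y y_s ->; rewrite sum_unitv inE; case: eqVneq y_s => // ->.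
  by rewrite (negPf x_s).
by move/(_ sum_eq0).
Qed.

Lemma adj_sym F : symmetric (adj F).
Proof. by move=> x y; rewrite /adj /= setUC. Qed.

Lemma adj_setU1 e F x y : adj (e |: F) x y = ([set x; y] == e) || adj F x y.
Proof. by rewrite /adj /= !inE. Qed.

Lemma connect_adj_sym F : connect_sym (adj F).
Proof. exact/sym_connect_sym/adj_sym. Qed.

(* The sum of the coordinates over a connected component vanishes on every edge,
   hence on the whole span. *)
Lemma mem_span_incid S x y : simple_graph S ->
  (unitv x + unitv y \in <<map incid S>>%VS) = connect (adj [set:: S]) x y.
Proof.
move=> simpleS; apply/idP/idP => [|/connectP[p]].
  pose A := [set z | connect (adj [set:: S]) x z].
  move/(@span_sum_eq0 A); under eq_bigr do rewrite ffunE.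
  rewrite big_split /= !sum_unitv !inE connect0.
  case: connect => // sum_xy.
  suff /sum_xy : forall u, u \in map incid S -> \sum_(z in A) u z = 0.
    by rewrite addr0 => /eqP; rewrite oner_eq0.
  move=> u /mapP[e eS ->].
  have /cards2P[a [b [ab eE]]] := allP simpleS _ eS; rewrite eE in eS *.
  rewrite incid2 //; under eq_bigr do rewrite ffunE.
  have adj_ab : adj [set:: S] a b by rewrite /adj /= inE.
  rewrite big_split /= !sum_unitv !inE.
  rewrite (same_connect_r (connect_adj_sym _) (connect1 adj_ab)).
  by apply: GRing.addrr_pchar2; apply: pchar_Fp.
elim: p x => [|z p IH] x /= => [_ ->|/andP[]]; first by rewrite addvv mem0v.
rewrite /adj /= inE => xzS /IH{}IH /IH; apply: unitv_add_trans.
by rewrite -incid2 ?memv_span ?map_f // (simple_graph_end_neq simpleS xzS).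
Qed.

Definition even_space C : {vspace space} :=
  <<[seq unitv x + unitv y | x <- enum C, y <- enum C]>>.

Lemma even_space_subP C U :
  reflect {in C &, forall x y, unitv x + unitv y \in U} (even_space C <= U)%VS.
Proof.
apply: (iffP span_subvP) => [sub x y xC yC|sub v /allpairsP[[x y]]] /=.
  by apply/sub/allpairs_f; rewrite mem_enum.
by rewrite !mem_enum => -[xC yC ->]; apply: sub.
Qed.

Lemma mem_even_space C :
  {in C &, forall x y, unitv x + unitv y \in even_space C}.
Proof. exact/even_space_subP. Qed.

Lemma dim_even_space C : \dim (even_space C) = #|C|.-1.
Proof.
case: (set_0Vmem C) => [->|[x0 x0C]].
  by rewrite /even_space enum_set0 span_nil dimv0 cards0.
apply/eqP; rewrite eqn_leq; apply/andP; split.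
  pose star := [seq unitv x + unitv x0 | x <- enum (C :\ x0)].
  have mem_star x : x \in C -> unitv x + unitv x0 \in <<star>>%VS.
    move=> xC; case: (eqVneq x x0) => [->|x_x0]; first by rewrite addvv mem0v.
    by apply: memv_span; apply: map_f; rewrite mem_enum !inE x_x0.
  apply: (@leq_trans (\dim <<star>>)); last first.
    by rewrite (leq_trans (dim_span _)) // size_map -cardE (cardsD1 x0 C) x0C.
  apply/dimvS/even_space_subP => x y /mem_star xC /mem_star yC.
  by apply: unitv_add_trans xC _; rewrite addrC.
have sub : (<<map unitv (enum C)>> <= even_space C + <[unitv x0]>)%VS.
  apply/span_subvP => v /mapP[x]; rewrite mem_enum => xC ->.
  have -> : unitv x = (unitv x + unitv x0) + unitv x0.
    by rewrite -addrA addvv addr0.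
  by rewrite memv_add ?mem_even_space ?memv_line.
have := leq_trans (dimvS sub) (dimv_add_leqif _ _).
have /eqP -> := free_unitv (enum_uniq C).
rewrite size_map -cardE dim_vline => C_le; rewrite leq_predLR -addn1.
by rewrite (leq_trans C_le) // leq_add2l leq_b1.
Qed.

Lemma span_incid_even_space C S :
  simple_graph S -> all (fun e => e \subset C) S ->
  (<<map incid S>> <= even_space C)%VS.
Proof.
move=> /allP simpleS /allP SC; apply/span_subvP => v /mapP[e eS ->].
have /cards2P[a [b [ab eE]]] := simpleS _ eS.
move: (SC _ eS); rewrite eE subUset !sub1set incid2 // => /andP[aC bC].
exact: mem_even_space.
Qed.

Lemma graph_rank_card C S :
  simple_graph S -> all (fun e => e \subset C) S -> (graph_rank S <= #|C|.-1)%N.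
Proof.
move=> simpleS SC; rewrite -dim_even_space.
exact/dimvS/span_incid_even_space.
Qed.

Lemma connected_graph_rank C S :
  simple_graph S -> all (fun e => e \subset C) S ->
  connected_graph C [set:: S] <-> (#|C| <= (graph_rank S).+1)%N.
Proof.
move=> simpleS SC; rewrite -leq_predLR -dim_even_space.
split=> [conn|C_le].
  apply/dimvS/even_space_subP => x y xC yC.
  by rewrite mem_span_incid //; apply: conn.
have /eqP spanE : <<map incid S>>%VS == even_space C.
  by rewrite eqEdim span_incid_even_space.
by move=> x y xC yC; rewrite -mem_span_incid // spanE mem_even_space.
Qed.

Definition edges_inside C S : seq {set V} :=
  [seq e : {set V} <- S | e \subset C].

Lemma induced_edges_inside C S :
  induced_edges [set:: S] C = [set:: edges_inside C S].
Proof. by apply/setP => e; rewrite !inE mem_filter andbC. Qed.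

Section EdgesInside.

Variables (C : {set V}) (S : seq {set V}).
Hypotheses (simpleS : simple_graph S) (forestS : forest S).

Lemma simple_edges_inside : simple_graph (edges_inside C S).
Proof. exact/(simple_graph_sub _ simpleS)/mem_subseq/filter_subseq. Qed.

Lemma rank_edges_inside :
  graph_rank (edges_inside C S) = size (edges_inside C S).
Proof. exact/forest_rank/free_map_filter. Qed.

Lemma forest_connected_inside :
  connected_graph C (induced_edges [set:: S] C) <->
  (#|C| <= (size (edges_inside C S)).+1)%N.
Proof.
rewrite induced_edges_inside -rank_edges_inside.
by apply: connected_graph_rank; rewrite ?simple_edges_inside ?filter_all.
Qed.

Lemma size_edges_inside :
  (size (edges_inside C S) <= #|C|.-1
     ?= iff (#|C| <= (size (edges_inside C S)).+1))%N.
Proof.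
rewrite -leq_predLR; apply: leqif_geq.
by rewrite -rank_edges_inside graph_rank_card ?simple_edges_inside ?filter_all.
Qed.

End EdgesInside.

End Incidence.

Arguments incid {V} A.
Arguments unitv {V} x.

Section Communities.

Variables (V : finType) (cs : seq {set V}).

Implicit Types (C e : {set V}) (S : seq {set V}).

Definition multiplicity e : nat := count (fun C => e \subset C) cs.

Definition saturates S : bool :=
  all (fun C => #|C| <= (size (edges_inside C S)).+1)%N cs.

Definition tilde_weight (R : realFieldType) (X : R) e (w : R) : R :=
  (multiplicity e)%:R + (X - w) / X.

Lemma sum_multiplicity S :
  (\sum_(e <- S) multiplicity e = \sum_(C <- cs) size (edges_inside C S))%N.
Proof.
under eq_bigr do rewrite /multiplicity -sum1_count big_mkcond.
rewrite exchange_big; apply: eq_bigr => C _.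
by rewrite size_filter -sum1_count [RHS]big_mkcond.
Qed.

Lemma sum_multiplicity_leqif S : simple_graph S -> forest S ->
  (\sum_(e <- S) multiplicity e <= \sum_(C <- cs) #|C|.-1 ?= iff saturates S)%N.
Proof.
move=> simpleS forestS; rewrite sum_multiplicity /saturates.
elim: cs => [|C Cs IH]; first by rewrite !big_nil; apply: leqif_refl.
by rewrite !big_cons; apply: leqif_add (size_edges_inside C simpleS forestS) IH.
Qed.

Lemma saturatesP S : simple_graph S -> forest S ->
  reflect (forall C, C \in cs -> connected_graph C (induced_edges [set:: S] C))
          (saturates S).
Proof.
move=> simpleS forestS.
by apply: (iffP allP) => sat C /sat; rewrite forest_connected_inside.
Qed.

End Communities.

Section Solutions.

Variables (R : realFieldType) (V : finType) (I : cnws R V).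

Implicit Types (F : {set {set V}}) (S : seq {set V}).

Lemma solution_connect F x y :
  hypergraph_connected (comms I) -> solution I F -> connect (adj F) x y.
Proof.
move=> hyp_conn [_ _ _ conn].
have connC C u v : C \in comms I -> u \in C -> v \in C -> connect (adj F) u v.
  move=> Cc uC vC; apply: connect_sub (conn C Cc u v uC vC) => a b.
  by rewrite /adj /= inE => /andP[abF _]; apply: connect1.
case: (eqVneq x y) => [->|/hyp_conn[C [s [sub pathC xC yl]]]].
  exact: connect0.
elim: s C x sub pathC xC yl => [|D s IH] C x sub /=.
  by move=> _; apply: connC; apply: sub; rewrite mem_head.
case/andP=> /set0Pn[z /setIP[zC zD]] pathD xC yl.
have Cc : C \in comms I by apply: sub; rewrite mem_head.
apply: connect_trans (connC C x z Cc xC zC) _.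
by apply: IH pathD zD yl => E Es; apply: sub; rewrite inE Es orbT.
Qed.

Lemma edges_simple S : {subset S <= edges I} -> simple_graph S.
Proof. by move=> sub; apply/allP => e /sub/edges_card2->. Qed.

Lemma solution_simple F : solution I F -> simple_graph (enum F).
Proof.
case=> /subsetP sub _ _ _; apply: edges_simple => e.
by rewrite mem_enum => /sub.
Qed.

Lemma weight_uniq S : uniq S -> weight I [set:: S] = \sum_(e <- S) omega I e.
Proof.
by move=> uniqS; rewrite (big_uniq _ uniqS); apply: eq_bigl => e; rewrite inE.
Qed.

Lemma forest_solutionP S : {subset S <= edges I} -> forest S ->
  reflect (solution I [set:: S])
    [&& (size S)%:Z <= ell I, \sum_(e <- S) omega I e <= budget I
      & saturates (comms I) S].
Proof.
move=> sub forestS.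
have uniqS := forest_uniq forestS; have simpleS := edges_simple sub.
have cardS : #|[set:: S]| = size S by rewrite cardsE (card_uniqP uniqS).
have subS : [set:: S] \subset edges I.
  by apply/subsetP => e; rewrite inE => /sub.
rewrite /solution cardS weight_uniq //.
apply: (iffP and3P) => [[le_ell le_b]|[_ le_ell le_b]] /(saturatesP _ _ _) sat.
  by split=> //; apply: sat.
by split=> //; apply: sat.
Qed.

Hypothesis ellE : ell I = #|V|%:Z - 1.
Hypothesis comms_connected : hypergraph_connected (comms I).

Lemma solution_spanning_tree F :
  solution I F -> forest (enum F) /\ #|V| = #|F|.+1.
Proof.
move=> solF; have simpleF := solution_simple solF.
have F_lt : (#|F| < #|V|)%N by case: solF => _; rewrite ellE; lia.
have V_le : (#|V| <= (graph_rank (enum F)).+1)%N.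
  rewrite -cardsT -connected_graph_rank ?set_enum //.
    by move=> x y _ _; apply: solution_connect.
  by apply/allP => e _; apply: subsetT.
have := graph_rank_size (enum F); rewrite -cardE => rank_le.
split; last by apply/eqP; rewrite eqn_leq F_lt (leq_trans V_le).
rewrite /forest /free size_map -cardE eqn_leq rank_le.
exact: leq_trans F_lt V_le.
Qed.

Lemma solution_saturates F : solution I F -> saturates (comms I) (enum F).
Proof.
move=> solF; have [forestF _] := solution_spanning_tree solF.
apply/(saturatesP _ (solution_simple solF) forestF).
by rewrite set_enum; case: solF.
Qed.

Variable X : R.
Hypothesis omega_lt : forall e, e \in edges I -> omega I e < X.

Definition tilde_omega e : R := tilde_weight (comms I) X e (omega I e).

Lemma omega_bound_gt0 e : e \in edges I -> 0 < X.
Proof. by move=> eI; apply: le_lt_trans (omega_ge0 eI) (omega_lt eI). Qed.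

Lemma weight_fraction_itv e :
  e \in edges I -> 0 < (X - omega I e) / X <= 1.
Proof.
move=> eI; have X_gt0 := omega_bound_gt0 eI.
rewrite divr_gt0 ?subr_gt0 ?omega_lt //= ler_pdivrMr // mul1r lerBlDr lerDl.
exact: omega_ge0.
Qed.

Lemma tilde_omega_ge0 e : e \in edges I -> 0 <= tilde_omega e.
Proof.
by move/weight_fraction_itv/andP => [/ltW frac_ge0 _]; rewrite addr_ge0.
Qed.

(* The second term of [tilde_omega] lies in ]0, 1], so the order is
   lexicographic, by multiplicity first. *)
Lemma leq_multiplicity e f : e \in edges I -> f \in edges I ->
  tilde_omega f <= tilde_omega e ->
  (multiplicity (comms I) f <= multiplicity (comms I) e)%N.
Proof.
move=> /weight_fraction_itv/andP[_ e_le1] /weight_fraction_itv/andP[f_gt0 _].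
move=> tilde_le; rewrite leqNgt; apply/negP; rewrite -(ler_nat R) -natr1.
by move: tilde_le; rewrite /tilde_omega /tilde_weight; lra.
Qed.

Lemma sum_tilde_omega S : X != 0 ->
  \sum_(e <- S) tilde_omega e =
  (\sum_(e <- S) multiplicity (comms I) e)%:R + (size S)%:R
    - (\sum_(e <- S) omega I e) / X.
Proof.
move=> X_neq0; elim: S => [|e S IH].
  by rewrite !big_nil /= mul0r !addr0 subr0.
by rewrite !big_cons IH /= /tilde_omega /tilde_weight natrD -natr1; field.
Qed.

Variable es : seq {set V}.
Hypothesis mem_es : es =i edges I.
Hypothesis es_sorted : pairwise (fun e f => tilde_omega f <= tilde_omega e) es.

Let T := greedy incid 0 es.

Lemma kruskal_sub_edges : {subset T <= edges I}.
Proof. by move=> e /(mem_subseq (subseq_greedy _ _ _)); rewrite mem_es. Qed.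

Section OptimalTree.

Variable F : {set {set V}}.
Hypothesis solF : solution I F.

Let F_sub : {subset enum F <= es}.
Proof.
by case: solF => /subsetP sub _ _ _ e; rewrite mem_enum mem_es => /sub.
Qed.

Lemma size_kruskal : size T = #|F|.
Proof.
have [forestF cardV] := solution_spanning_tree solF.
have simple_es : simple_graph es by apply: edges_simple => e; rewrite mem_es.
apply/eqP; rewrite size_greedy eqn_leq; apply/andP; split; last first.
  by rewrite cardE -forest_rank // graph_rank_sub.
rewrite -[#|F|]/(#|F|.+1.-1) -cardV -cardsT graph_rank_card //.
by apply/allP => e _; apply: subsetT.
Qed.

(* Kruskal's tree maximizes the total multiplicity, whose upper bound is
   attained by the solution F. *)
Lemma kruskal_multiplicity :
  saturates (comms I) T /\
  (\sum_(e <- T) multiplicity (comms I) e =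
   \sum_(e <- enum F) multiplicity (comms I) e)%N.
Proof.
have [forestF _] := solution_spanning_tree solF.
have [_ F_attains] :=
  sum_multiplicity_leqif (comms I) (solution_simple solF) forestF.
have [T_le T_attains] := sum_multiplicity_leqif (comms I)
  (edges_simple kruskal_sub_edges) (free_greedy incid es).
rewrite solution_saturates // in F_attains.
have le_FT : (\sum_(e <- enum F) multiplicity (comms I) e <=
              \sum_(e <- T) multiplicity (comms I) e)%N.
  rewrite -(ler_nat R) !natr_sum; apply: greedy_max_weight => //.
  apply: (sub_in_pairwise (P := mem es)) es_sorted; last exact/allP.
  by move=> e f /=; rewrite !mem_es ler_nat => ? ?; apply: leq_multiplicity.
have eq_TF : (\sum_(e <- T) multiplicity (comms I) e =
              \sum_(e <- enum F) multiplicity (comms I) e)%N.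
  by apply/eqP; rewrite eqn_leq le_FT (eqP F_attains) T_le.
by split=> //; rewrite -T_attains eq_TF.
Qed.

Lemma kruskal_min_omega : \sum_(e <- T) omega I e <= weight I F.
Proof.
have [forestF _] := solution_spanning_tree solF.
rewrite -[F in weight I F]set_enum weight_uniq ?enum_uniq //.
case enumF: (enum F) F_sub => [|e0 F'] sub; rewrite -enumF.
  suff -> : T = [::] by rewrite enumF !big_nil.
  by apply: size0nil; rewrite size_kruskal cardE enumF.
have X_gt0 : 0 < X.
  by apply: (@omega_bound_gt0 e0); rewrite -mem_es sub // mem_head.
have es_ge0 : {in es, forall e, 0 <= tilde_omega e}.
  by move=> e; rewrite mem_es; apply: tilde_omega_ge0.
have := greedy_max_weight es_sorted es_ge0 F_sub forestF.
rewrite -/T !sum_tilde_omega ?gt_eqF // size_kruskal -cardE.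
by rewrite kruskal_multiplicity.2 lerD2l lerN2 ler_pM2r // invr_gt0.
Qed.

Lemma kruskal_optimal :
  solution I [set:: T] /\ weight I [set:: T] <= weight I F.
Proof.
have forestT := free_greedy incid es; have [_ F_ell F_b _] := solF.
split; last by rewrite weight_uniq ?kruskal_min_omega // forest_uniq.
apply/forest_solutionP => //; first exact: kruskal_sub_edges.
rewrite size_kruskal F_ell (le_trans kruskal_min_omega) //.
by rewrite kruskal_multiplicity.1.
Qed.

End OptimalTree.

End Solutions.

Section Timed.

Implicit Types (A B : Type) (k l : nat).

Definition returns A (t : timed A) k (a : A) : Prop :=
  result t = a /\ (cost t <= k)%N.

Lemma returnsW A (t : timed A) k l a :
  (k <= l)%N -> returns t k a -> returns t l a.
Proof. by move=> kl [ta tk]; split=> //; apply: leq_trans kl. Qed.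

Lemma returns_ret A (a : A) : returns (ret a) 0 a.
Proof. by []. Qed.

Lemma returns_charge A j (t : timed A) k a :
  returns t k a -> returns (charge j t) (j + k) a.
Proof. by case=> ta tk; split=> //; rewrite leq_add2l. Qed.

Lemma returns_tick A (t : timed A) k a :
  returns t k a -> returns (tick t) k.+1 a.
Proof. exact: returns_charge. Qed.

Lemma returns_bind A B (t : timed A) (f : A -> timed B) k l a b :
  returns t k a -> returns (f a) l b -> returns (bind t f) (k + l) b.
Proof. by case=> <- tk [fb fl]; split; [exact: fb | exact: leq_add]. Qed.

Lemma returns_map A B (t : timed A) (f : A -> B) k a :
  returns t k a -> returns (let* x := t in ret (f x)) k (f a).
Proof. by move=> [<- tk]; split=> //; rewrite /cost /= addn0. Qed.

Variables A B : Type.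

Lemma returns_countT (p : pred A) s :
  returns (countT p s) (size s).+1 (count p s).
Proof. by elim: s => //= x s IH; apply/returns_tick/returns_map/IH. Qed.

Lemma returns_sizeT (s : seq A) : returns (countT predT s) (size s).+1 (size s).
Proof. by rewrite -[X in returns _ _ X]count_predT; apply: returns_countT. Qed.

Lemma returns_foldT (f : A -> B -> B) b s :
  returns (foldT f b s) (size s).+1 (foldr f b s).
Proof. by elim: s => //= x s IH; apply/returns_tick/returns_map/IH. Qed.

Lemma returns_mapT (f : A -> timed B) (g : A -> B) k s :
  (forall x, returns (f x) k (g x)) ->
  returns (mapT f s) (size s * k.+1).+1 (map g s).
Proof.
move=> fg; elim: s => //= x s IH; rewrite mulSn addSn -addnS.
exact/returns_tick/(returns_bind (fg x))/returns_map/IH.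
Qed.

Lemma returns_allT (p : A -> timed bool) (q : pred A) k s :
  (forall x, returns (p x) k (q x)) ->
  returns (allT p s) (size s * k.+1).+1 (all q s).
Proof.
move=> pq; elim: s => //= x s IH; rewrite mulSn addSn -addnS.
apply/returns_tick/(returns_bind (pq x)).
by case: (q x) => //; apply: returnsW (returns_ret _).
Qed.

End Timed.

Section MergeSort.

Variables (A : eqType) (leT : rel A).
Hypothesis leT_total : total leT.

Lemma returns_mergeT s1 s2 :
  returns (mergeT leT s1 s2) (size s1 + size s2).+1 (merge leT s1 s2).
Proof.
elim: s1 s2 => [|x1 s1 IH1]; first by case.
elim=> [|x2 s2 IH2]; first by split=> //=; rewrite addn0.
rewrite [mergeT _ _ _]/= [merge _ _ _]/=; case: ifP => _.
  exact/returns_tick/returns_map/IH1.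
by rewrite addnS; apply/returns_tick/returns_map/IH2.
Qed.

Lemma returns_merge_pairsT ss : all (sorted leT) ss ->
  exists ss', [/\ (size ss').*2 <= (size ss).+1, all (sorted leT) ss',
    perm_eq (flatten ss') (flatten ss) &
    returns (merge_pairsT leT ss) (size (flatten ss) + size ss).+1 ss']%N.
Proof.
elim/ltn_ind: (size ss) {-2}ss (erefl (size ss)) => n IH {}ss.
case: ss => [|s1 [|s2 ss]] size_ss.
- by exists [::].
- by move=> ss_sorted; exists [:: s1]; rewrite perm_refl.
case/and3P=> sorted1 sorted2 sorted_ss.
have [|ss' [size_ss' ss'_sorted perm_ss' pairsP]] :=
  IH (size ss) _ ss erefl sorted_ss.
  by rewrite -size_ss /= leqnSn.
exists (merge leT s1 s2 :: ss'); split.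
- by rewrite /= doubleS !ltnS.
- by rewrite /= (merge_sorted leT_total).
- by rewrite /= catA perm_cat // perm_merge.
apply: returnsW (returns_tick (returns_bind (returns_mergeT s1 s2)
  (returns_map (cons _) pairsP))).
by rewrite /= !size_cat; lia.
Qed.

Lemma returns_merge_allT fuel j ss :
  (size ss <= 2 ^ j)%N -> (j <= fuel)%N -> all (sorted leT) ss ->
  exists s, [/\ sorted leT s, perm_eq s (flatten ss) &
    returns (merge_allT leT fuel ss)
      (j * (size (flatten ss) + size ss + 2)).+1 s]%N.
Proof.
elim: fuel j ss => [|fuel IH] j [|s1 [|s2 ss]] size_le j_le ss_sorted.
- by exists [::]; split.
- by exists s1; rewrite /= cats0; split=> //; case/andP: ss_sorted.
- by move: j_le size_le; rewrite leqn0 => /eqP->.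
- by exists [::]; split.
- by exists s1; rewrite /= cats0; split=> //; case/andP: ss_sorted.
case: j size_le j_le => // j size_le j_le.
have [ss' [size_ss' ss'_sorted perm_ss' pairsP]] :=
  returns_merge_pairsT ss_sorted.
have [|s [s_sorted perm_s mergedP]] := IH j ss' _ j_le ss'_sorted.
  by move: size_ss' size_le; rewrite expnS mul2n; lia.
exists s; split=> //; first exact: perm_trans perm_ss'.
apply: returnsW (returns_tick (returns_bind pairsP mergedP)).
rewrite (perm_size perm_ss') mulSn; move: size_ss'.
set n := size (flatten _); set r := size (s1 :: _) => size_ss'.
have : (j * (n + size ss' + 2) <= j * (n + r + 2))%N.
  by rewrite leq_mul2l; move: size_ss' => /=; lia.
by lia.
Qed.

Lemma returns_sortT s :
  exists s', [/\ sorted leT s', perm_eq s' s &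
    returns (sortT leT s)
      ((size s).+2 + up_log 2 (size s) * (2 * size s + 2)) s']%N.
Proof.
pose ss := [seq [:: x] | x <- s].
have flat_ss : flatten ss = s by rewrite /ss; elim: (s) => //= x t ->.
have [|||s' [s'_sorted perm mergedP]] :=
  @returns_merge_allT (size s) (up_log 2 (size s)) ss.
- by rewrite size_map up_logP.
- by rewrite up_log_min // ltnW // ltn_expl.
- by rewrite /ss; elim: (s).
rewrite flat_ss size_map in perm mergedP.
exists s'; split=> //.
apply: returnsW (returns_bind
  (returns_mapT s (fun x => returns_ret [:: x])) mergedP).
by rewrite muln1 mul2n -addnn; lia.
Qed.

End MergeSort.

Section UnionFind.

Variable V : finType.

Implicit Types (d : dsf V) (x y z a b u v : V) (F : {set {set V}}).
Implicit Types (root : V -> V) (depth : V -> nat).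

(* The existence of [depth] excludes cycles of parents; union by size maintains
   [depth_card], which makes the depth logarithmic. *)
Record dsf_inv d root depth : Prop := DsfInv {
  rootE : forall x, root x = if parent d x == x then x else root (parent d x);
  depthE : forall x,
    depth x = if parent d x == x then 0%N else (depth (parent d x)).+1;
  depth_card : forall x, (2 ^ depth x <= card_of d (root x))%N;
  card_root : forall x, card_of d (root x) = #|[set z | root z == root x]|
}.

Lemma dsf_inv_new : dsf_inv (Dsf id (fun=> 1%N)) id (fun=> 0%N).
Proof.
split=> x /=; rewrite ?eqxx //; rewrite -(cards1 x).
by congr #|pred_of_set _|; apply/setP => z; rewrite !inE.
Qed.

Section Invariant.

Variables (d : dsf V) (root : V -> V) (depth : V -> nat).
Hypothesis inv : dsf_inv d root depth.

Lemma parent_root x : parent d (root x) = root x.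
Proof.
elim/ltn_ind: (depth x) {-2}x (erefl (depth x)) => n IH {}x depth_x.
rewrite (rootE inv x); case: eqP => // /eqP/negPf px; apply: IH erefl.
by rewrite -depth_x (depthE inv x) px.
Qed.

Lemma root_root x : root (root x) = root x.
Proof. by rewrite [LHS](rootE inv) parent_root eqxx. Qed.

Lemma depth_root x : depth (root x) = 0%N.
Proof. by rewrite (depthE inv) parent_root eqxx. Qed.

Lemma depth_log x : (depth x <= trunc_log 2 #|V|)%N.
Proof.
apply: trunc_log_max => //; apply: leq_trans (depth_card inv x) _.
by rewrite (card_root inv) max_card.
Qed.

Lemma depth_lt_card x : (depth x < #|V|)%N.
Proof.
apply: leq_trans (ltn_expl (depth x) (ltnSn 1)) _.
by rewrite (leq_trans (depth_card inv x)) // (card_root inv) max_card.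
Qed.

Lemma returns_findT_fuel fuel x :
  (depth x <= fuel)%N -> returns (findT d fuel x) (depth x).+1 (root x).
Proof.
elim: fuel x => [|fuel IH] x; rewrite (depthE inv) (rootE inv) /=;
  case: eqP => // _ depth_le.
exact/returns_tick/IH.
Qed.

Lemma returns_findT x : returns (findT d #|V| x) (trunc_log 2 #|V|).+1 (root x).
Proof.
apply: returnsW (returns_findT_fuel (ltnW (depth_lt_card x))).
by rewrite ltnS depth_log.
Qed.

End Invariant.

Definition merge_root root a b z : V := if root z == a then b else root z.

Definition merge_depth root depth a z : nat :=
  if root z == a then (depth z).+1 else depth z.

Definition attach d a b : dsf V :=
  Dsf (write (parent d) a b)
      (write (card_of d) b (card_of d a + card_of d b)%N).

Lemma linkE d x y :
  link d x y =
  if (card_of d x < card_of d y)%N then attach d x y else attach d y x.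
Proof. by rewrite /link /attach (addnC (card_of d y)). Qed.

Lemma card_merged_class root a b : a != b ->
  #|[set z | merge_root root a b z == b]| =
  (#|[set z | root z == a]| + #|[set z | root z == b]|)%N.
Proof.
move=> ab; rewrite -cardsUI [X in (_ + X)%N](_ : _ = 0%N) ?addn0.
  congr #|pred_of_set _|; apply/setP => z; rewrite !inE /merge_root.
  by case: (eqVneq (root z) a) => // _; rewrite eqxx.
apply/eqP; rewrite cards_eq0; apply/eqP/setP => z; rewrite !inE.
by case: eqVneq => // ->; rewrite (negPf ab).
Qed.

Lemma attach_inv d root depth x y :
  dsf_inv d root depth -> root x != root y ->
  (card_of d (root x) <= card_of d (root y))%N ->
  dsf_inv (attach d (root x) (root y)) (merge_root root (root x) (root y))
          (merge_depth root depth (root x)).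
Proof.
move=> inv; move: (root_root inv x) (root_root inv y).
move: (depth_root inv x) (depth_root inv y) (card_root inv x) (card_root inv y).
move: (root x) (root y) => a b.
move=> depth_a depth_b card_a card_b root_a root_b ab card_le.
have ba : b == a = false by rewrite eq_sym (negPf ab).
split=> z; rewrite /merge_root /merge_depth /attach /write /=.
- case: (eqVneq z a) => [->|za]; first by rewrite root_a root_b ba eqxx.
  rewrite (rootE inv z).
  by case: (eqVneq (parent d z) z) => _; rewrite ?(negPf za).
- case: (eqVneq z a) => [->|za].
    by rewrite root_a root_b ba eqxx depth_a depth_b.
  rewrite (rootE inv z) (depthE inv z).
  by case: (eqVneq (parent d z) z) => _; [rewrite (negPf za) | case: ifP].
- have := depth_card inv z; case: (eqVneq (root z) a) => [->|_].
    by rewrite eqxx expnS mul2n -addnn => dz; rewrite leq_add // (leq_trans dz).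
  by case: eqP => // -> dz; apply: leq_trans dz (leq_addl _ _).
have merged :
    #|[set u | merge_root root a b u == b]| = (card_of d a + card_of d b)%N.
  by rewrite card_merged_class // card_a card_b.
case: (eqVneq (root z) a) => [_|za]; first by rewrite eqxx -merged.
case: (eqVneq (root z) b) => [->|zb]; first by rewrite -merged.
rewrite (card_root inv); congr #|pred_of_set _|; apply/setP => u; rewrite !inE.
case: (eqVneq (root u) a) => // ->.
by rewrite (eq_sym a) (negPf za) (eq_sym b) (negPf zb).
Qed.

Definition represents root F : Prop :=
  forall x y, (root x == root y) = connect (adj F) x y.

Lemma represents_new : represents id [set:: [::]].
Proof.
move=> x y; apply/eqP/idP => [->|]; first exact: connect0.
by case/connectP=> -[|z p] //=; rewrite /adj /= inE.
Qed.

Lemma represents_merge root F x y : represents root F ->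
  represents (merge_root root (root x) (root y)) ([set x; y] |: F).
Proof.
move=> rootF u v; set F' := _ |: F.
have sub_conn a b : root a = root b -> connect (adj F') a b.
  move/eqP; rewrite rootF; apply: connect_sub => {}a {}b abF.
  by apply: connect1; rewrite adj_setU1 abF orbT.
have xyF' : connect (adj F') x y by apply: connect1; rewrite adj_setU1 eqxx.
have conn_merge z : exists2 t, merge_root root (root x) (root y) z = root t &
    connect (adj F') z t.
  rewrite /merge_root; case: eqP => [zx|_]; last by exists z.
  by exists y => //; apply: connect_trans (sub_conn _ _ zx) xyF'.
apply/eqP/idP => [|uv].
  have [s -> us] := conn_merge u; have [t -> vt] := conn_merge v.
  move/sub_conn/(connect_trans us)/connect_trans; apply.
  by rewrite connect_adj_sym.
have merge_xy z :
    z \in [set x; y] -> merge_root root (root x) (root y) z = root y.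
  by rewrite /merge_root !inE => /orP[]/eqP->; rewrite ?eqxx ?if_same.
pose same_root := [pred z | merge_root root (root x) (root y) z ==
                            merge_root root (root x) (root y) u].
have closed_root : closed (adj F') same_root.
  move=> a b; rewrite adj_setU1 !inE => /orP[/eqP ab|/connect1].
    by rewrite (merge_xy a) ?(merge_xy b) // -ab ?set21 ?set22.
  by rewrite -rootF /merge_root => /eqP->.
have := closed_connect closed_root uv.
by rewrite !inE eqxx => /esym/eqP->.
Qed.

Lemma link_inv d root depth F x y :
  dsf_inv d root depth -> represents root F -> root x != root y ->
  exists root' depth', dsf_inv (link d (root x) (root y)) root' depth' /\
    represents root' ([set x; y] |: F).
Proof.
move=> inv rootF xy; rewrite linkE; case: ltnP => [/ltnW card_le|card_le].
  exists (merge_root root (root x) (root y)), (merge_depth root depth (root x)).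
  by split; [apply: attach_inv | apply: represents_merge].
exists (merge_root root (root y) (root x)), (merge_depth root depth (root y)).
rewrite eq_sym in xy; rewrite (setUC [set x] [set y]).
by split; [apply: attach_inv | apply: represents_merge].
Qed.

End UnionFind.

Section EdgeEquality.

Variables (R : realFieldType) (V : finType).

Definition tuple_of_edge (e : edge R V) : V * V * R := (src e, dst e, wgt e).

Definition edge_of_tuple (t : V * V * R) : edge R V := Edge t.1.1 t.1.2 t.2.

Lemma tuple_of_edgeK : cancel tuple_of_edge edge_of_tuple.
Proof. by case. Qed.

HB.instance Definition _ := Equality.copy (edge R V) (can_type tuple_of_edgeK).

End EdgeEquality.

Local Notation edge_ends := (map (@ends _ _)).

Section Programs.

Variables (R : realFieldType) (V : finType).

Implicit Types (es T : seq (edge R V)) (e : edge R V) (cs : seq {set V}).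
Implicit Types (C : {set V}) (S : seq {set V}).

Local Notation lg_n := (trunc_log 2 #|V|).

Definition edge_incid e : {ffun V -> ('F_2)^o} := incid (ends e).

Definition kruskal_forest es : seq (edge R V) := greedy edge_incid 0 es.

Lemma ends_subset e C : (ends e \subset C) = (src e \in C) && (dst e \in C).
Proof. by rewrite subUset !sub1set. Qed.

Lemma edge_ends_kruskal es :
  edge_ends (kruskal_forest es) = greedy incid 0 (edge_ends es).
Proof. exact: map_greedy. Qed.

Lemma size_kruskal_forest es :
  size (kruskal_forest es) = graph_rank (edge_ends es).
Proof. by rewrite size_greedy /graph_rank -map_comp. Qed.

Lemma size_simple_graph S :
  simple_graph S -> uniq S -> (size S <= 2 ^ (2 * lg_n.+1))%N.
Proof.
move=> /allP simpleS /card_uniqP <-.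
have sub : S \subset [set e : {set V} | #|e| == 2].
  by apply/subsetP => e /simpleS; rewrite inE.
apply: leq_trans (subset_leq_card sub) _; rewrite card_draws bin2.
apply: (@leq_trans (#|V| * #|V|)).
  by rewrite -divn2 (leq_trans (leq_div _ _)) // leq_mul2l leq_pred orbT.
by rewrite mul2n -addnn expnD leq_mul // ltnW // trunc_log_ltn.
Qed.

Lemma returns_greedyT d root depth S es :
  dsf_inv d root depth -> represents root [set:: S] ->
  simple_graph S -> simple_graph (edge_ends es) ->
  returns (greedyT d es) (size es * (2 * lg_n + 3)).+1
          (greedy edge_incid <<map incid S>> es).
Proof.
elim: es d root depth S => [|e es IH] d root depth S inv rootS simpleS //=.
case/andP=> card_e simple_es.
have loopless : src e != dst e.
  by move: card_e; rewrite cards2; case: (src e == dst e).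
rewrite {1}/edge_incid /ends incid2 // mem_span_incid // -rootS.
set x := root (src e); set y := root (dst e); set T := if _ then _ else _.
have branch : returns (if x == y then greedyT d es
    else let* F := greedyT (link d x y) es in ret (e :: F))
    (size es * (2 * lg_n + 3)).+1 T.
  rewrite /T; case: eqVneq => [_|xy].
    exact: IH inv rootS simpleS simple_es.
  have [root' [depth' [inv' rootS']]] := link_inv inv rootS xy.
  rewrite -/(ends e) -set_cons in rootS'.
  have simpleS' : simple_graph (ends e :: S) by rewrite /= card_e.
  have := IH _ _ _ _ inv' rootS' simpleS' simple_es.
  by rewrite /= span_cons addvC; apply: returns_map.
apply: returnsW (returns_tick (returns_bind (returns_findT inv (src e))
  (returns_bind (returns_findT inv (dst e)) branch))).
by rewrite mulSn; lia.
Qed.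

Lemma returns_greedy_forestT es : simple_graph (edge_ends es) ->
  returns (greedy_forestT es) (2 * #|V| + (size es * (2 * lg_n + 3)).+1)
          (kruskal_forest es).
Proof.
move=> simple_es.
have newP : returns (new_dsf V) (2 * #|V|) (Dsf id (fun=> 1%N)).
  by split=> //; rewrite /cost /= addn0 mul2n addnn.
have := returns_greedyT (dsf_inv_new V) (@represents_new V) isT simple_es.
rewrite span_nil => greedyP.
exact: (returns_bind (f := (@greedyT R V)^~ es) newP greedyP).
Qed.

Lemma returns_connectedT es : simple_graph (edge_ends es) ->
  returns (connectedT es) (size es * (2 * lg_n + 7) + 5)
          (#|V| <= (size (kruskal_forest es)).+1)%N.
Proof.
move=> simple_es; set T := kruskal_forest es.
have T_le : (size T <= size es)%N by rewrite size_subseq // subseq_greedy.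
have forest_test : returns (if ((size es).+1 < #|V|)%N then ret false
    else let* F := greedy_forestT es in
         let* k := countT predT F in ret (#|V| <= k.+1)%N)
    (size es * (2 * lg_n + 6) + 4) (#|V| <= (size T).+1)%N.
  case: ltnP => [es_lt|n_le].
    have /negbTE -> : ~~ (#|V| <= (size T).+1)%N.
      by rewrite -ltnNge (leq_ltn_trans _ es_lt).
    exact: returnsW (returns_ret _).
  apply: returnsW (returns_bind (returns_greedy_forestT simple_es)
    (returns_map (fun k => #|V| <= k.+1)%N (returns_sizeT T))).
  by move: #|V| lg_n (size T) (size es) n_le T_le => n l t m; lia.
by apply: returnsW (returns_bind (returns_sizeT es) forest_test); lia.
Qed.

Definition maxweight1 es : R := foldr (fun e r => Num.max (wgt e) r) 0 es + 1.

Lemma returns_maxweight1T es :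
  returns (maxweight1T es) (size es).+1 (maxweight1 es).
Proof. exact/returns_map/returns_foldT. Qed.

Lemma wgt_lt_maxweight1 es e : e \in es -> wgt e < maxweight1 es.
Proof.
rewrite /maxweight1 => e_es; rewrite ltr_pwDr //.
elim: es e_es => //= f es IH; rewrite inE le_max => /orP[/eqP->|/IH->].
  by rewrite lexx.
by rewrite orbT.
Qed.

Definition edge_tilde_omega cs (X : R) e : R :=
  tilde_weight cs X (ends e) (wgt e).

Lemma returns_tilde_omegaT cs X e :
  returns (tilde_omegaT cs X e) (size cs).+1 (edge_tilde_omega cs X e).
Proof.
rewrite /edge_tilde_omega /tilde_weight /multiplicity.
rewrite (eq_count (ends_subset e)).
exact/returns_map/returns_countT.
Qed.

Lemma returns_kruskalT (w : edge R V -> R) es : simple_graph (edge_ends es) ->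
  exists es', [/\ perm_eq es' es, pairwise (fun e f => w f <= w e) es' &
    returns (kruskalT [seq (e, w e) | e <- es])
      (2 * #|V| + size es * (2 * lg_n + 5) +
       up_log 2 (size es) * (2 * size es + 2) + 4) (kruskal_forest es')].
Proof.
pose heavier (p q : edge R V * R) := q.2 <= p.2.
have heavier_total : total heavier by move=> p q; apply: le_total.
have heavier_trans : transitive heavier.
  by move=> q p r /= qp rq; apply: le_trans rq qp.
have [ks [ks_sorted perm sortP]] :=
  returns_sortT heavier_total [seq (e, w e) | e <- es].
move=> simple_es; exists (map fst ks).
have ksE : ks = [seq (e, w e) | e <- map fst ks].
  rewrite -map_comp map_id_in // => p; rewrite (perm_mem perm).
  by case/mapP=> e _ ->.
have perm_es : perm_eq (map fst ks) es.
  by rewrite (perm_trans (perm_map fst perm)) // -map_comp map_id.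
split=> //.
  move: ks_sorted.
  by rewrite (sorted_pairwise heavier_trans) ksE pairwise_map -ksE.
have simple_ks : simple_graph (edge_ends (map fst ks)).
  by rewrite /simple_graph (perm_all _ (perm_map _ perm_es)).
apply: returnsW (returns_bind sortP (returns_bind
  (returns_mapT ks (fun p => returns_ret p.1))
  (returns_greedy_forestT simple_ks))).
rewrite !size_map (perm_size perm) size_map.
by move: (up_log _ _ * _)%N => s; rewrite !mulnDr; lia.
Qed.

Definition accepts cs (l : int) (b : R) T : bool :=
  [&& (size T)%:Z <= l, \sum_(e <- T) wgt e <= b & saturates cs (edge_ends T)].

Lemma returns_comm_connectedT T C :
  returns (comm_connectedT T C) (#|V| + size T + 2)
    (#|C| <= (size (edges_inside C (edge_ends T))).+1)%N.
Proof.
have -> : #|C| = count (fun v => v \in C) (enum V).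
  by rewrite cardE -size_filter enumT.
have -> : size (edges_inside C (edge_ends T)) =
    count (fun e => (src e \in C) && (dst e \in C)) T.
  by rewrite size_filter count_map; apply: eq_count => e; apply: ends_subset.
apply: returnsW (returns_bind (returns_countT _ _)
  (returns_map (fun k => count (fun v => v \in C) (enum V) <= k.+1)%N
    (returns_countT _ T))).
by rewrite -cardT; lia.
Qed.

Lemma returns_is_solutionT cs (l : int) (b : R) T :
  returns (is_solutionT cs l b T)
    (2 * size T + 3 + size cs * (#|V| + size T + 3)) (accepts cs l b T).
Proof.
have sumE : foldr (fun e (r : R) => wgt e + r) 0 T = \sum_(e <- T) wgt e.
  by rewrite unlock.
rewrite /accepts -sumE; set w := foldr _ _ _.
have test : returns (if ((size T)%:Z <= l) && (w <= b)
    then allT (comm_connectedT T) cs else ret false)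
    (size cs * (#|V| + size T + 2).+1).+1
    [&& (size T)%:Z <= l, w <= b & saturates cs (edge_ends T)].
  rewrite andbA; case: (_ && _).
    exact/returns_allT/returns_comm_connectedT.
  exact: returnsW (returns_ret _).
apply: returnsW (returns_bind (returns_sizeT T)
  (returns_bind (returns_foldT _ _ _) test)).
by rewrite -!addnS; lia.
Qed.

Lemma returns_algorithm es cs (l : int) (b : R) :
  simple_graph (edge_ends es) -> uniq (edge_ends es) ->
  exists es', [/\ perm_eq es' es,
    pairwise (fun e f => edge_tilde_omega cs (maxweight1 es) f <=
                         edge_tilde_omega cs (maxweight1 es) e) es' &
    returns (algorithm es cs l b) (30 * ((size es).+1 * (size cs + lg_n).+1))
      (let T := kruskal_forest es' in
       if (#|V| <= (size T).+1)%N && accepts cs l b T then Some T else None)].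
Proof.
move=> simple_es uniq_es; set w := edge_tilde_omega cs (maxweight1 es).
have [es' [perm es'_sorted treeP]] := returns_kruskalT w simple_es.
exists es'; split=> //=; set T := kruskal_forest es' in treeP *.
have T_le : (size T <= size es)%N.
  by rewrite -(perm_size perm) size_subseq // subseq_greedy.
have := returns_connectedT simple_es.
rewrite size_kruskal_forest -(graph_rank_perm (perm_map _ perm)).
rewrite -size_kruskal_forest -/T; case: ltnP => [_|n_le] connP.
  apply: returnsW (returns_bind connP (returns_ret None)).
  by rewrite addn0; move: (size es) (size cs) lg_n => m c k; nia.
have weightsP : returns
    (mapT (fun e => let* x := tilde_omegaT cs (maxweight1 es) e in
                    ret (e, x)) es)
    (size es * (size cs).+2).+1 [seq (e, w e) | e <- es].
  by apply: returns_mapT => e; apply: returns_map; apply: returns_tilde_omegaT.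
apply: returnsW; last first.
  apply: returns_bind connP _; apply: returns_bind (returns_maxweight1T es) _.
  apply: returns_bind weightsP _; apply: returns_bind treeP _.
  exact/returns_map/returns_is_solutionT.
have rounds_le : (up_log 2 (size es) * (2 * size es + 2) <=
                  2 * lg_n.+1 * (2 * size es + 2))%N.
  rewrite leq_mul // up_log_min // -(size_map (@ends R V)).
  exact: size_simple_graph.
have comms_le : (size cs * (#|V| + size T + 3) <=
                 size cs * (2 * size es + 4))%N.
  by rewrite leq_mul2l; lia.
move: #|V| (size T) (size es) (size cs) lg_n (up_log _ _ * _)%N (_ * (_ + 3))%N
  n_le T_le rounds_le comms_le => n t m c k r q.
by nia.
Qed.

End Programs.

Section Correctness.

Variables (R : realFieldType) (V : finType) (I : cnws R V).

Implicit Types (es T : seq (edge R V)) (F : {set {set V}}) (f : {set V}).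

Lemma encodes_perm es es' : perm_eq es' es -> encodes I es -> encodes I es'.
Proof.
move=> perm [edges_es /eq_in_map wgt_es]; split.
  exact: perm_trans (perm_map _ perm) edges_es.
by apply/eq_in_map => e; rewrite (perm_mem perm); apply: wgt_es.
Qed.

Lemma encodes_edges es : encodes I es -> edge_ends es =i edges I.
Proof. by case=> /perm_mem perm _ e; rewrite perm mem_enum. Qed.

Lemma encodes_wgt es :
  encodes I es -> {in es, forall e, wgt e = omega I (ends e)}.
Proof. by case=> _ /eq_in_map. Qed.

Lemma encodes_uniq es : encodes I es -> uniq (edge_ends es).
Proof. by case=> /perm_uniq-> _; apply: enum_uniq. Qed.

Lemma encodes_simple es : encodes I es -> simple_graph (edge_ends es).
Proof.
by move=> esI; apply: (edges_simple (I := I)) => e; rewrite encodes_edges.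
Qed.

Lemma omega_lt_maxweight1 es f :
  encodes I es -> f \in edges I -> omega I f < maxweight1 es.
Proof.
move=> esI; rewrite -(encodes_edges esI) => /mapP[e e_es ->].
by rewrite -(encodes_wgt esI) ?wgt_lt_maxweight1.
Qed.

Lemma acceptsP es T :
  encodes I es -> {subset T <= es} -> forest (edge_ends T) ->
  reflect (solution I (edge_set T)) (accepts (comms I) (ell I) (budget I) T).
Proof.
move=> esI sub forestT; rewrite /accepts -(size_map (@ends R V)).
have -> : \sum_(e <- T) wgt e = \sum_(f <- edge_ends T) omega I f.
  by rewrite big_map; apply: eq_big_seq => e /sub/(encodes_wgt esI).
apply: forest_solutionP forestT => f /mapP[e /sub e_es ->].
by rewrite -(encodes_edges esI) map_f.
Qed.

Section SortedEdges.

Hypothesis ellE : ell I = #|V|%:Z - 1.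
Hypothesis comms_connected : hypergraph_connected (comms I).

Variables (X : R) (es : seq (edge R V)).
Hypothesis omega_lt : forall f, f \in edges I -> omega I f < X.
Hypothesis esI : encodes I es.
Hypothesis es_sorted :
  pairwise (fun e e' => edge_tilde_omega (comms I) X e' <=
                        edge_tilde_omega (comms I) X e) es.

Let T := kruskal_forest es.

Let ends_sorted :
  pairwise (fun f f' => tilde_omega I X f' <= tilde_omega I X f)
           (edge_ends es).
Proof.
rewrite pairwise_map; apply: (sub_in_pairwise (P := mem es)) es_sorted.
  move=> e e' e_es e'_es.
  by rewrite /= /edge_tilde_omega /tilde_omega !(encodes_wgt esI).
exact/allP.
Qed.

Lemma kruskal_forest_optimal F : solution I F ->
  [/\ #|V| = (size T).+1, solution I (edge_set T) &
      weight I (edge_set T) <= weight I F].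
Proof.
move=> solF; rewrite -(size_map (@ends R V)) /edge_set edge_ends_kruskal.
have [solT le_TF] := kruskal_optimal ellE comms_connected omega_lt
  (encodes_edges esI) ends_sorted solF.
have [_ cardV] := solution_spanning_tree ellE comms_connected solF.
by rewrite (size_kruskal ellE comms_connected (encodes_edges esI) solF).
Qed.

Lemma kruskal_answer_correct :
  match (if (#|V| <= (size T).+1)%N && accepts (comms I) (ell I) (budget I) T
         then Some T else None) with
  | Some T => min_weight_solution I (edge_set T)
  | None => forall F, ~ solution I F
  end.
Proof.
have acceptsT : reflect (solution I (edge_set T))
    (accepts (comms I) (ell I) (budget I) T).
  apply: acceptsP esI _ _; first exact/mem_subseq/subseq_greedy.
  by rewrite edge_ends_kruskal; apply: free_greedy.
case: ifPn => [/andP[_ /acceptsT solT]|rejected F solF].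
  by split=> // F /kruskal_forest_optimal[].
have [cardV /acceptsT acceptT _] := kruskal_forest_optimal solF.
by rewrite cardV leqnn acceptT in rejected.
Qed.

End SortedEdges.

End Correctness.

Theorem theorem19 :
  exists K : nat,
  forall (R : realType) (V : finType) (I : cnws R V) (es : seq (edge R V)),
    ell I = #|V|%:Z - 1 ->
    hypergraph_connected (comms I) ->
    encodes I es ->
    let n := #|V| in
    let m := #|edges I| in
    let c := size (comms I) in
    let run := algorithm es (comms I) (ell I) (budget I) in
    (cost run <= K * (maxn 1 m * maxn 1 (c + trunc_log 2 n)))%N /\
    match result run with
    | Some T => min_weight_solution I (edge_set T)
    | None => forall F : {set {set V}}, ~ solution I F
    end.
Proof.
exists 120 => R V I es ellE comms_connected esI n m c run.
have [es' [perm es'_sorted [-> run_cost]]] :=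
  returns_algorithm (comms I) (ell I) (budget I) (encodes_simple esI)
    (encodes_uniq esI).
split; last first.
  apply: (kruskal_answer_correct ellE comms_connected) es'_sorted.
  - by move=> f fI; apply: omega_lt_maxweight1 esI fI.
  - exact: encodes_perm perm esI.
have size_es : size es = m.
  by rewrite -(size_map (@ends R V)) (perm_size esI.1) -cardE.
rewrite size_es in run_cost; apply: leq_trans run_cost _.
rewrite -[120]/(30 * 4)%N -mulnA leq_mul2l /=.
exact: mulSS_leq_maxn.
Qed.
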